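(* Let $\mathcal{X}$ be a (real or complex) Banach space with $\dim \mathcal{X}\geq 2$, let $\mathcal{N}$ be a nest on $\mathcal{X}$ such that each $N\in\mathcal{N}$ with $N_{-}=N$ is complemented in $\mathcal{X}$, and let $\tau,\delta,\rho: Alg\mathcal{N}\rightarrow Alg\mathcal{N}$ be linear maps. (i) $\tau$ satisfies ($A,B\in Alg\mathcal{N}$, $AB=0 \Longrightarrow A\tau(B)=0$) if and only if there is $D\in Alg\mathcal{N}$ such that $\tau(A)=AD$ for all $A\in Alg\mathcal{N}$. (ii) $\delta$ satisfies ($A,B\in Alg\mathcal{N}$, $AB=0 \Longrightarrow \delta(A)B=0$) if and only if there is $D\in Alg\mathcal{N}$ such that $\delta(A)=DA$ for all $A\in Alg\mathcal{N}$. (iii) $\rho$ satisfies ($A,B\in Alg\mathcal{N}$, $AB=0 \Longrightarrow A\rho(B)=\rho(A)B=0$) if and only if there is $D\in Alg\mathcal{N}$ with $AD=DA$ for all $A\in Alg\mathcal{N}$ such that $\rho(A)=AD$ for all $A\in Alg\mathcal{N}$.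
   Context: A nest $\mathcal{N}$ on a Banach space $\mathcal{X}$ is a chain (under inclusion) of norm-closed subspaces of $\mathcal{X}$ containing $\{0\}$ and $\mathcal{X}$ such that for every family $\{N_i\}$ of elements of $\mathcal{N}$, both $\bigcap N_i$ and $\bigvee N_i$ (the closed linear span of the $N_i$) belong to $\mathcal{N}$. The nest algebra $Alg\mathcal{N}$ is the algebra of all bounded linear operators on $\mathcal{X}$ that leave every member of $\mathcal{N}$ invariant. For $N\in\mathcal{N}$, $N_{-}:=\bigvee\{M\in\mathcal{N} : M\subsetneq N\}$. Linear maps are linear over the scalar field of $\mathcal{X}$ and are not assumed continuous. *)

(* Defs.v *)
From HB Require Import structures.
From mathcomp Require Import all_boot all_order all_algebra.
From mathcomp Require Import complex.
From mathcomp Require Import all_classical all_reals all_analysis.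

Set Implicit Arguments.
Unset Strict Implicit.
Unset Printing Implicit Defensive.

Import Order.TTheory GRing.Theory Num.Theory.

Local Open Scope classical_set_scope.
Local Open Scope ring_scope.

Section nests.
Variables (K : numFieldType) (X : normedModType K).
Implicit Types (A M : set X).

Definition linear_subspace A :=
  A 0 /\ forall (a : K) (x y : X), A x -> A y -> A (a *: x + y).

Definition closed_subspace A := linear_subspace A /\ closed A.

Definition closed_span A := closure (smallest linear_subspace A).

(* A closed algebraic complement; on a Banach space the associated projection
   is then automatically bounded. *)
Definition complemented M :=
  exists M' : set X,
    [/\ closed_subspace M', M `&` M' = [set 0] &
        forall x, exists y z, [/\ M y, M' z & x = y + z]].

(* The family F may be empty: its intersection is then the whole space and the
   closed span of its union is {0}. *)
Definition is_nest (N : set (set X)) :=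
  [/\ N `<=` closed_subspace,
      total_on N subset,
      N [set 0] /\ N setT &
      forall F : set (set X), F `<=` N ->
        N (\bigcap_(M in F) M) /\ N (closed_span (\bigcup_(M in F) M))].

Record nest := Nest { nest_set : set (set X); nestP : is_nest nest_set }.

Implicit Type N : nest.

Definition nest_minus N M :=
  closed_span (\bigcup_(M' in [set M' | nest_set N M' /\ M' `<` M]) M').

Definition bounded_operator (T : X -> X) :=
  linear T /\ exists c : K, forall x, `|T x| <= c * `|x|.

Definition in_nest_alg N : set (X -> X) :=
  [set T | bounded_operator T /\ forall M, nest_set N M -> T @` M `<=` M].

Record nest_alg N := NestAlg {
  nest_fun :> X -> X;
  nest_funP : nest_fun \in in_nest_alg N }.

End nests.

Section nest_algebra.
Variables (K : numFieldType) (X : normedModType K) (N : nest X).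
Implicit Types A B C : nest_alg N.

HB.instance Definition _ := [isSub of nest_alg N for @nest_fun K X N].
HB.instance Definition _ := [Choice of nest_alg N by <:].

Lemma nest_alg_submod_closed :
  submod_closed (mem (in_nest_alg N) : {pred X -> X}).
Proof.
split=> [|a f g].
  apply/mem_set; split; first split.
  - by move=> a x y; rewrite /= scaler0 addr0.
  - by exists 0 => x; rewrite normr0 mul0r.
  - move=> M NM _ [x Mx <-].
    by have [/(_ _ NM)[[M0 _] _] _ _ _] := nestP N; exact: M0.
move=> /set_mem [[lf [c cf]] fN] /set_mem [[lg [d dg]] gN].
apply/mem_set; split; first split.
- move=> b x y; rewrite !fctE lf lg !scalerDr !scalerA addrACA.
  by rewrite (mulrC a b).
- exists (`|a| * c + d) => x; rewrite !fctE.
  rewrite (le_trans (ler_normD _ _))// normrZ mulrDl -mulrA.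
  by rewrite lerD// ler_wpM2l.
- move=> M NM _ [x Mx <-].
  have [/(_ _ NM)[[_ Mlin] _] _ _ _] := nestP N.
  by apply: Mlin; [apply: (fN M NM); exists x | apply: (gN M NM); exists x].
Qed.

HB.instance Definition _ := GRing.SubChoice_isSubLmodule.Build K (X -> X)
  _ (nest_alg N) (GRing.submod_closed_semi nest_alg_submod_closed).

Lemma nest_alg_linear A : linear A.
Proof. by have /set_mem[[]] := nest_funP A. Qed.

Lemma nest_alg_idP : idfun \in in_nest_alg N.
Proof.
apply/mem_set; split; first split=> //.
- by exists 1 => x; rewrite mul1r.
- by move=> M _ _ [x Mx <-].
Qed.

Lemma nest_alg_compP A B : A \o B \in in_nest_alg N.
Proof.
have /set_mem [[lA [c cA]] AN] := nest_funP A.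
have /set_mem [[lB [d dB]] BN] := nest_funP B.
apply/mem_set; split; first split.
- by move=> a x y /=; rewrite lB lA.
- exists (`|c| * d) => x /=; have [c0|] := boolP (0 <= c).
    by rewrite ger0_norm// (le_trans (cA _))// -mulrA ler_wpM2l.
  move=> c0; have x0 y : y = 0 :> X.
    apply/eqP; apply: contraNT c0 => y0.
    by rewrite -(@pmulr_lge0 _ `|y|) ?normr_gt0// (le_trans _ (cA y)).
  by rewrite (x0 x) (x0 (A _)) normr0 mulr0.
- move=> M NM _ [x Mx <-] /=.
  by apply: (AN M NM); exists (B x) => //; apply: (BN M NM); exists x.
Qed.

Definition nest_alg_one := NestAlg nest_alg_idP.
Definition nest_alg_mul A B := NestAlg (nest_alg_compP A B).

Lemma nest_alg_mulA : associative nest_alg_mul.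
Proof. by move=> A B C; apply: val_inj. Qed.

Lemma nest_alg_mul1 : left_id nest_alg_one nest_alg_mul.
Proof. by move=> A; apply: val_inj. Qed.

Lemma nest_alg_1mul : right_id nest_alg_one nest_alg_mul.
Proof. by move=> A; apply: val_inj. Qed.

Lemma nest_alg_mulDl : left_distributive nest_alg_mul +%R.
Proof. by move=> A B C; apply: val_inj. Qed.

Lemma nest_alg_mulDr : right_distributive nest_alg_mul +%R.
Proof.
move=> A B C; apply: val_inj; apply/funext => x /=.
by have := nest_alg_linear A 1 (B x) (C x); rewrite !scale1r.
Qed.

HB.instance Definition _ := GRing.Zmodule_isPzRing.Build (nest_alg N)
  nest_alg_mulA nest_alg_mul1 nest_alg_1mul nest_alg_mulDl nest_alg_mulDr.

Lemma nest_alg0 : (0 : nest_alg N) = (fun=> 0) :> (X -> X).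
Proof. by []. Qed.

Lemma nest_algD A B : A + B = (fun x => A x + B x) :> (X -> X).
Proof. by []. Qed.

Lemma nest_algZ (a : K) A : a *: A = (fun x => a *: A x) :> (X -> X).
Proof. by []. Qed.

Lemma nest_algM A B : A * B = A \o B :> (X -> X).
Proof. by []. Qed.

Lemma nest_alg1 : (1 : nest_alg N) = idfun :> (X -> X).
Proof. by []. Qed.

End nest_algebra.

(* Main.v *)
From HB Require Import structures.
Require Import Defs.
From mathcomp Require Import all_boot all_order all_algebra.
From mathcomp Require Import complex.
From mathcomp Require Import all_classical all_reals all_analysis.
From mathcomp Require Import ring lra.

Set Implicit Arguments.
Unset Strict Implicit.
Unset Printing Implicit Defensive.
Import Order.TTheory GRing.Theory Num.Theory.
Import numFieldNormedType.Exports.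
Local Open Scope classical_set_scope.
Local Open Scope ring_scope.

(** The algebra has enough idempotents, and a zero-product condition tested
on an idempotent E is very strong: since E (B - E B) = 0 and
(1 - E) (E B) = 0, the hypothesis on tau gives tau (E B) = E tau B for every B,
and by linearity tau (S B) = S tau B for every S in the linear span of the
idempotents.  If S and S A both lie in that span, then
S tau A = tau (S A 1) = S A tau 1, hence S (tau A - A tau 1) = 0.  So the
theorem follows once the span is seen to contain a set of operators S that is
stable under multiplication by the algebra and annihilates no nonzero operator.
The operators of rank one in the algebra form such a set.

Write f # x for the operator y |-> f y x.  It belongs to the algebra when some
member M of the nest contains x and f vanishes on M_-.

- Span ([nest_rank_one_idempotent_span]).  If f x <> 0, then f # x is a
  multiple of an idempotent.  If M_- <> M, perturbing f and x within these
  constraints makes f # x a linear combination of operators of this kind.  If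
  M_- = M, then f x = 0 for all admissible x and f and this fails; but then M is
  complemented, the projection P onto M along a complement lies in the algebra,
  and P + f # x is idempotent because f vanishes on the range of P.

- Separation ([rank_one_left_separating], [rank_one_right_separating]).  By
  Hahn-Banach there is a functional vanishing on M_- and not at a given vector
  outside M_-.  If (f # x) T = 0 for all admissible f and x, the range of T is
  in M_- for every nonzero M, hence in L, the intersection of the nonzero
  members; were L nonzero, the range would be in L_- = 0.  If T (f # x) = 0 for
  all of them, T vanishes on every M with M_- different from the whole space,
  and such M have a dense union.

The analytic input is the Hahn-Banach theorem over the real and the complex
field and the boundedness of the projection defined by two closed complementary
subspaces.  Both are proved for real spaces and transferred to complex ones by
restriction of scalars. *)

(** * Subspaces and bounded linear forms *)

Section subspace.
Variables (K : numFieldType) (X : normedModType K).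
Implicit Types M : set X.

Lemma linear_subspaceD M x y : linear_subspace M -> M x -> M y -> M (x + y).
Proof. by move=> [_ ML] Mx My; rewrite -[x]scale1r; exact: ML. Qed.

Lemma linear_subspaceZ M a x : linear_subspace M -> M x -> M (a *: x).
Proof. by move=> [M0 ML] Mx; rewrite -[_ *: _]addr0; exact: ML. Qed.

Lemma linear_subspaceB M x y : linear_subspace M -> M x -> M y -> M (x - y).
Proof.
move=> sM Mx My; apply: linear_subspaceD => //.
by rewrite -scaleN1r; exact: linear_subspaceZ.
Qed.

End subspace.

Section closed_subspaces.
Variables (K : numFieldType) (X : normedModType K).
Implicit Types (A M : set X).

Lemma closed_span_sub A M :
  closed_subspace M -> A `<=` M -> closed_span A `<=` M.
Proof.
move=> [sM cM] AM x; move/(closureS (smallest_sub sM AM)); exact: cM.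
Qed.

Lemma sub_closed_span A : A `<=` closed_span A.
Proof.
by move=> x Ax; apply: subset_closure; apply: (@sub_smallest _ _ A A) Ax.
Qed.

(** The constant c of a bounded operator is an arbitrary scalar; it is
nonnegative as soon as the space has a nonzero vector. *)
Lemma closed_subspace_kernel (T : X -> X) :
  bounded_operator T -> closed_subspace [set x | T x = 0].
Proof.
move=> [linT [c cT]].
have T0 : T 0 = 0.
  by have := linT (-1) 0 0; rewrite scaler0 addr0 scaleN1r addNr.
split; first by split=> //= a x y Tx Ty; rewrite linT Tx Ty scaler0 addr0.
move=> x clx /=; apply: contrapT => /eqP Tx0.
have x0 : 0 < `|x|.
  by rewrite normr_gt0; apply: contraNneq Tx0 => ->; rewrite T0.
have c0 : 0 <= c by rewrite -(pmulr_lge0 _ x0) (le_trans _ (cT x)).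
have Tx_gt0 : 0 < `|T x| by rewrite normr_gt0.
have c1_gt0 : 0 < c + 1 by rewrite ltr_wpDl.
have [m [/= Tm]] := clx _ (nbhsx_ballx x _ (divr_gt0 Tx_gt0 c1_gt0)).
rewrite -ball_normE /= ltr_pdivlMr// => xm.
suff Tx_le : `|T x| <= `|x - m| * (c + 1).
  by have := le_lt_trans Tx_le xm; rewrite ltxx.
have -> : T x = T (x - m).
  by rewrite -scaleN1r addrC linT Tm scaler0 add0r.
by rewrite (le_trans (cT _))// mulrC ler_wpM2l// lerDl.
Qed.

End closed_subspaces.

Section bounded_functionals.
Variables (K : numFieldType) (X : normedModType K).
Implicit Types f g : X -> K.

Definition bounded_functional f :=
  scalar f /\ exists2 c, 0 <= c & forall x, `|f x| <= c * `|x|.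

Definition rank_one (x : X) f : X -> X := fun y => f y *: x.

Lemma bounded_functionalD f g : bounded_functional f -> bounded_functional g ->
  bounded_functional (fun x => f x + g x).
Proof.
move=> [fL [c c0 fc]] [gL [d d0 gd]]; split=> [a x y|].
  by rewrite fL gL /=; ring.
exists (c + d) => [|x]; first exact: addr_ge0.
by rewrite (le_trans (ler_normD _ _))// mulrDl lerD.
Qed.

Lemma bounded_functional_comp f (T : X -> X) :
  bounded_functional f -> bounded_operator T -> bounded_functional (f \o T).
Proof.
move=> [fL [c c0 fc]] [TL [d dT]]; split=> [a x y /=|]; first by rewrite TL fL.
exists (c * `|d|) => [|x /=]; first exact: mulr_ge0.
rewrite (le_trans (fc _))// -mulrA ler_wpM2l// (le_trans (dT x))//.
rewrite -[leRHS]ger0_norm ?mulr_ge0// normrM normr_id -normrM.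
by rewrite ger0_norm ?lexx// (le_trans _ (dT x)).
Qed.

Lemma scalar_funZ f a x : scalar f -> f (a *: x) = a * f x.
Proof.
move=> fL; have f0 : f 0 = 0.
  by have := fL (-1) 0 0; rewrite scaler0 addr0 mulN1r addNr.
by have := fL a x 0; rewrite addr0 f0 addr0.
Qed.

Lemma scalar_funD f x y : scalar f -> f (x + y) = f x + f y.
Proof. by move=> fL; have := fL 1 x y; rewrite scale1r mul1r. Qed.

Lemma bounded_operator_rank_one x f :
  bounded_functional f -> bounded_operator (rank_one x f).
Proof.
move=> [fL [c c0 fc]]; split=> [a y z|].
  by rewrite /rank_one fL scalerDl scalerA.
exists (c * `|x|) => y.
by rewrite normrZ mulrAC ler_wpM2r.
Qed.

End bounded_functionals.

(** * Sublinear forms and the Hahn-Banach theorem *)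

Section sublinear.
Variables (R : realType) (V : lmodType R).

Definition sublinear (p : V -> R) :=
  (forall x y, p (x + y) <= p x + p y) /\
  (forall t x, 0 <= t -> p (t *: x) <= t * p x).

Lemma sublinear0 p : sublinear p -> p 0 = 0.
Proof.
move=> [pD pZ]; apply/eqP; rewrite eq_le; apply/andP; split.
  by have := pZ 0 0 (lexx 0); rewrite scaler0 mul0r.
by have := pD 0 0; rewrite addr0; lra.
Qed.

Lemma sublinearZ p t x : sublinear p -> 0 <= t -> p (t *: x) = t * p x.
Proof.
move=> sp; rewrite le_eqVlt => /orP[/eqP <-|t0].
  by rewrite scale0r mul0r sublinear0.
apply/eqP; rewrite eq_le (sp.2 _ _ (ltW t0)) /= -ler_pdivlMl//.
by rewrite -{1}[x](scalerK (lt0r_neq0 t0)) sp.2// invr_ge0 ltW.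
Qed.

Lemma sublinearN p x : sublinear p -> - p (- x) <= p x.
Proof.
by move=> sp; have := sp.1 x (- x); rewrite subrr sublinear0//; lra.
Qed.

(** Three infima are used below: along a half-line, over a chain of sublinear
forms, and over a subspace, where it is the distance. *)
Definition lower_envelope I (A : set I) (f : I -> V -> R) x :=
  inf [set f i x | i in A].

Section lower_envelope.
Variables (I : Type) (A : set I) (f : I -> V -> R).
Hypothesis A0 : A !=set0.
Hypothesis f_lb : forall x, exists b, forall i, A i -> b <= f i x.

Lemma lower_envelope_le i x : A i -> lower_envelope A f x <= f i x.
Proof.
move=> Ai; apply: ge_inf; last by exists i.
by have [b bP] := f_lb x; exists b => _ [j Aj <-]; exact: bP.
Qed.

Lemma le_lower_envelope b x :
  (forall i, A i -> b <= f i x) -> b <= lower_envelope A f x.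
Proof.
move=> bP; apply: lb_le_inf; first by have [i Ai] := A0; exists (f i x), i.
by move=> _ [i Ai <-]; exact: bP.
Qed.

(** The infimum of a family is sublinear without its members being so: only a
combination of two members must be dominated by a third one. *)
Lemma sublinear_lower_envelope :
  (forall i j x y, A i -> A j ->
     exists2 k, A k & f k (x + y) <= f i x + f j y) ->
  (forall i t x, A i -> 0 <= t ->
     exists2 k, A k & f k (t *: x) <= t * f i x) ->
  sublinear (lower_envelope A f).
Proof.
move=> fD fZ; split=> [x y|t x t0].
  rewrite -lerBlDr; apply: le_lower_envelope => i Ai.
  rewrite lerBlDr -lerBlDl; apply: le_lower_envelope => j Aj.
  rewrite lerBlDl; have [k Ak] := fD i j x y Ai Aj.
  exact/le_trans/lower_envelope_le.
have [->|tN0] := eqVneq t 0.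
  have [i Ai] := A0; have [k Ak] := fZ i 0 x Ai (lexx 0).
  by rewrite !mul0r; exact/le_trans/lower_envelope_le.
have {tN0}t0 : 0 < t by rewrite lt_def tN0.
rewrite -ler_pdivrMl//; apply: le_lower_envelope => i Ai.
rewrite ler_pdivrMl//; have [k Ak] := fZ i t x Ai (ltW t0).
exact/le_trans/lower_envelope_le.
Qed.

End lower_envelope.

Definition slack (p : V -> R) u (t : R) x := p (x + t *: u) - t * p u.

(** This form lies below p and is additive along u to the extent that p allows:
at - u it takes a value at most - p u. *)
Definition directional_envelope p u :=
  lower_envelope [set t : R | 0 <= t] (slack p u).

Section directional_envelope.
Variables (p : V -> R) (u : V).
Hypothesis sp : sublinear p.

Let ray0 : [set t : R | 0 <= t] !=set0. Proof. by exists 0 => /=. Qed.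

Let slack_lb x : exists b, forall t, 0 <= t -> b <= slack p u t x.
Proof.
exists (- p (- x)) => t t0; rewrite /slack -sublinearZ//.
by have := sp.1 (- x) (x + t *: u); rewrite addKr; lra.
Qed.

Lemma directional_envelope_le_slack x t :
  0 <= t -> directional_envelope p u x <= slack p u t x.
Proof. exact: (lower_envelope_le slack_lb). Qed.

Lemma directional_envelope_le x : directional_envelope p u x <= p x.
Proof.
have := directional_envelope_le_slack x (lexx 0).
by rewrite /slack scale0r addr0 mul0r subr0.
Qed.

Lemma sublinear_directional_envelope : sublinear (directional_envelope p u).
Proof.
apply: sublinear_lower_envelope => //=.
  move=> s t x y s0 t0; exists (s + t); first by rewrite /= addr_ge0.
  rewrite /slack scalerDl addrACA.
  by have := sp.1 (x + s *: u) (y + t *: u); lra.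
move=> s t x s0 t0; exists (t * s); first by rewrite /= mulr_ge0.
rewrite /slack -scalerA -scalerDr sublinearZ// mulrBr mulrA; exact: lexx.
Qed.

End directional_envelope.

Definition minimal_sublinear q :=
  sublinear q /\
  forall r, sublinear r -> (forall x, r x <= q x) -> r = q.

(** A minimal q coincides with its envelope in the direction y, and the bound
of that envelope at t = 1 is the missing superadditivity of q. *)
Lemma minimal_sublinearD q x y : minimal_sublinear q -> q (x + y) = q x + q y.
Proof.
move=> [sq minq]; apply/eqP; rewrite eq_le sq.1 /=.
have qy := minq _ (sublinear_directional_envelope y sq)
  (directional_envelope_le y sq).
have := directional_envelope_le_slack y sq x ler01.
by rewrite qy /slack scale1r mul1r lerBrDr.
Qed.

(** Zorn's lemma for the reversed pointwise order: the infimum of a chain is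
sublinear, and it is finite because each q below p satisfies
- p (- x) <= q x. *)
Lemma exists_minimal_sublinear p : sublinear p ->
  exists2 q, minimal_sublinear q & forall x, q x <= p x.
Proof.
move=> sp; pose below_p q := sublinear q /\ forall x, q x <= p x.
pose T := {q | below_p q}.
pose below (q r : T) := `[< forall x, sval r x <= sval q x >].
have [||||[q [sq qp]] qmin] := @Zorn T below.
- by move=> q; apply/asboolP.
- by move=> q r s /asboolP qr /asboolP rs; apply/asboolP => x; exact: le_trans.
- move=> [q Pq] [r Pr] /asboolP qr /asboolP rq; apply: eq_exist.
  by apply/funext => x; apply/eqP; rewrite eq_le qr rq.
- move=> A totA; have Pp : below_p p by [].
  (* adjoining p makes an empty chain harmless *)
  pose B := exist below_p p Pp |` A.
  have totB : total_on B below.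
    move=> i j [->|Ai] [->|Aj]; last exact: totA.
    - by left; apply/asboolP.
    - by left; apply/asboolP; case: (svalP j).
    - by right; apply/asboolP; case: (svalP i).
  have B0 : B !=set0 by exists (exist below_p p Pp); left.
  have B_lb x : exists b, forall i, B i -> b <= sval i x.
    exists (- p (- x)) => i _; have [si ip] := svalP i.
    by rewrite (le_trans _ (sublinearN x si))// lerN2.
  have env_le := lower_envelope_le B_lb.
  have Penv : below_p (lower_envelope B sval).
    split=> [|x]; last by apply: (env_le (exist below_p p Pp)); left.
    apply: sublinear_lower_envelope => //.
      move=> i j x y Bi Bj; have [/asboolP ij|/asboolP ij] := totB i j Bi Bj.
        exists j => //; have [[jD _] _] := svalP j.
        by rewrite (le_trans (jD _ _))// lerD2r.
      exists i => //; have [[iD _] _] := svalP i.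
      by rewrite (le_trans (iD _ _))// lerD2l.
    move=> i t x Bi t0; exists i => //.
    by have [[_ iZ] _] := svalP i; exact: iZ.
  exists (exist below_p _ Penv) => i Ai; apply/asboolP => x.
  by apply: env_le; right.
exists q => //; split=> // r sr rq.
have Pr : below_p r.
  by split=> // x; exact: le_trans (rq x) (qp x).
by have /(congr1 sval) := qmin (exist below_p r Pr) (asboolT rq).
Qed.

Lemma minimal_sublinear_scalar q : minimal_sublinear q -> scalar q.
Proof.
move=> mq; have [sq _] := mq.
have qN x : q (- x) = - q x.
  apply/eqP; rewrite -subr_eq0 opprK addrC -minimal_sublinearD// subrr.
  by rewrite sublinear0.
move=> a x y; rewrite minimal_sublinearD//; congr (_ + _).
have [a0|a0] := leP 0 a; first exact: sublinearZ.
rewrite -[a in LHS]opprK scaleNr qN sublinearZ ?oppr_ge0 ?(ltW a0)//.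
by rewrite mulNr opprK.
Qed.

(** Linear forms are the minimal sublinear forms, so no domain has to be
extended step by step: a minimal form below the envelope of p in the direction
u is linear, and its value at - u is at most - p u, so it reaches p at u. *)
Theorem hahn_banach p u : sublinear p ->
  exists f : V -> R, [/\ scalar f, forall x, f x <= p x & f u = p u].
Proof.
move=> sp; have spu := sublinear_directional_envelope u sp.
have [q mq qp] := exists_minimal_sublinear spu.
have qp' x : q x <= p x := le_trans (qp x) (directional_envelope_le u sp x).
exists q; split=> //; first exact: minimal_sublinear_scalar.
apply/eqP; rewrite eq_le qp' /=.
have := le_trans (qp (- u)) (directional_envelope_le_slack u sp _ ler01).
rewrite /slack scale1r addNr sublinear0// mul1r sub0r.
have := minimal_sublinearD u (- u) mq.
by rewrite subrr (sublinear0 mq.1); lra.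
Qed.

End sublinear.

(** The Hahn-Banach theorem for the distance to M, a sublinear form that
vanishes on M, is at most the norm, and is positive at u since M is closed. *)
Lemma real_separation (R : realType) (V : normedModType R) (M : set V) (u : V) :
  closed_subspace M -> ~ M u ->
  exists f : V -> R, [/\ scalar f, forall x, `|f x| <= `|x|,
    forall m, M m -> f m = 0 & f u != 0].
Proof.
move=> [sM clM] Mu.
have M_neq0 : M !=set0 by exists 0; exact: sM.1.
have dist_lb x : exists b, forall m, M m -> b <= `|x - m| by exists 0.
pose dist := lower_envelope M (fun m x : V => `|x - m|).
have dist_le x m : M m -> dist x <= `|x - m|.
  by move=> Mm; exact: (lower_envelope_le dist_lb).
have sdist : sublinear dist.
  apply: sublinear_lower_envelope => // [m n x y Mm Mn|m t x Mm t0].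
    exists (m + n); first exact: linear_subspaceD.
    by rewrite opprD addrACA ler_normD.
  exists (t *: m); first exact: linear_subspaceZ.
  by rewrite -scalerBr normrZ ger0_norm.
have dist_norm x : dist x <= `|x|.
  by have := dist_le x 0 sM.1; rewrite subr0.
have dist_gt0 : 0 < dist u.
  have /nbhs_ballP[e /= e0 eM] : nbhs u (~` M).
    by apply: open_nbhs_nbhs; split => //; exact: closed_openC.
  apply: lt_le_trans e0 _; apply: le_lower_envelope => // m Mm.
  by rewrite leNgt; apply/negP => um; apply: (eM m) => //; rewrite -ball_normE.
have [f [fL fd fu]] := hahn_banach u sdist.
have fN x : f (- x) = - f x.
  by rewrite -[- x]scaleN1r (scalar_funZ _ _ fL) mulN1r.
have f_le x : f x <= `|x| := le_trans (fd x) (dist_norm x).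
exists f; split=> // [x|m Mm|].
- by rewrite ler_norml f_le andbT -[f x]opprK lerN2 -fN -normrN f_le.
- have f_le0 n : M n -> f n <= 0.
    move=> Mn; rewrite (le_trans (fd n))// (le_trans (dist_le n n Mn))//.
    by rewrite subrr normr0.
  apply/eqP; rewrite eq_le f_le0//= -oppr_le0 -fN f_le0// -scaleN1r.
  exact: linear_subspaceZ.
- by rewrite fu gt_eqF.
Qed.

(** * Projections onto complemented subspaces *)

Section splitting.
Variables (K : numFieldType) (X : normedModType K).

(** When M and M' meet only in 0, such a P is the projection onto M along M'. *)
Definition splits M M' (P : X -> X) := forall x, M (P x) /\ M' (x - P x).

Section splits.
Variables (M M' : set X) (P : X -> X).
Hypotheses (sM : linear_subspace M) (sM' : linear_subspace M').
Hypotheses (MM' : M `&` M' = [set 0]) (MP : splits M M' P).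

Lemma splits_uniq y z : M y -> M' z -> P (y + z) = y.
Proof.
move=> My M'z; apply/eqP; rewrite -subr_eq0; apply/eqP.
have [MPyz M'Pyz] := MP (y + z).
suff: (M `&` M') (P (y + z) - y) by rewrite MM'.
split; first exact: linear_subspaceB.
rewrite (_ : _ - y = z - (y + z - P (y + z))).
  exact: linear_subspaceB.
by rewrite opprB opprD addrCA (addrCA z (- y)) subrr addr0.
Qed.

Lemma splits_id y : M y -> P y = y.
Proof.
by move=> My; rewrite -[X in P X]addr0 splits_uniq//; exact: sM'.1.
Qed.

Lemma splits_linear : linear P.
Proof.
move=> a x y; have [MPx M'Px] := MP x; have [MPy M'Py] := MP y.
have -> : a *: x + y = (a *: P x + P y) + (a *: (x - P x) + (y - P y)).
  by rewrite addrACA -scalerDr !subrKC.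
by apply: splits_uniq; [exact: sM.2|exact: sM'.2].
Qed.

End splits.
End splitting.

Section projection_bounded.
Variables (R : realType) (X : completeNormedModType R).
Variables (M M' : set X) (P : X -> X).
Hypotheses (cM : closed_subspace M) (cM' : closed_subspace M').
Hypotheses (MM' : M `&` M' = [set 0]) (MP : splits M M' P).

Let linP : linear P := splits_linear cM.1 cM'.1 MM' MP.

Let PB x y : P (x - y) = P x - P y.
Proof. by rewrite -scaleN1r addrC linP scaleN1r addrC. Qed.

Let PZ a x : P (a *: x) = a *: P x.
Proof.
have P0 : P 0 = 0 by rewrite -[X in P X](subrr 0) PB subrr.
by rewrite -[X in P X]addr0 linP P0 addr0.
Qed.

(** Baire: the closures of the sets where |P x| <= n cover the space, so one of
them has an interior point. *)
Lemma projection_somewhere_bounded :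
  exists n x0 (r : R), 0 < r /\ ball x0 r `<=` closure [set x | `|P x| <= n].
Proof.
pose A (n : nat) := [set x | `|P x| <= n%:R].
have [n nd] : exists n, ~ dense (~` closure (A n)).
  apply/existsNP => allD.
  have /(_ setT (ex_intro _ 0 I) openT)[x [_ Ax]] :
      dense (\bigcap_n ~` closure (A n)).
    by apply: Baire => n; split=> //; rewrite openC; exact: closed_closure.
  apply: (Ax (Num.truncn `|P x|).+1 I); apply: subset_closure; rewrite /A /=.
  by rewrite ltW// Num.Theory.truncnS_gt.
have [U [[x [oU Ux]] UA]] := denseNE nd.
have /nbhs_ballP[r /= r0 rU] := open_nbhs_nbhs (conj oU Ux).
exists n%:R, x, r; split=> // y /rU Uy; apply: contrapT => nAy.
by have : set0 y by rewrite -UA.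
Qed.

(** The sets {|P x| <= n} are symmetric and convex, so the ball obtained above
may be moved to the origin; by scaling, a vector in the ball of any radius s is
within s / 2 of some a with |P a| proportional to s. *)
Lemma projection_halving :
  exists2 C : R, 0 <= C & forall x s, `|x| <= s -> 0 <= s ->
    exists a, `|P a| <= C * s /\ `|x - a| <= s / 2.
Proof.
have [n [x0 [r [r0 rA]]]] := projection_somewhere_bounded.
have near0 h e : `|h| < r -> 0 < e -> exists2 a, `|P a| <= n & `|h - a| < e.
  move=> hr e0.
  have [|a [aA ae]] := rA (x0 + h) _ _ (nbhsx_ballx (x0 + h) e e0).
    by rewrite -ball_normE /= opprD addNKr normrN.
  have [|b [bA be]] := rA (x0 - h) _ _ (nbhsx_ballx (x0 - h) e e0).
    by rewrite -ball_normE /= opprB addrC subrK.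
  move: ae be; rewrite -!ball_normE /= => ae be.
  (* half the difference of approximants of x0 + h and of x0 - h *)
  exists (2^-1 *: (a - b)).
    rewrite PZ PB normrZ ger0_norm ?invr_ge0// ler_pdivrMl//.
    by rewrite (le_trans (ler_normB _ _))// mulr2n mulrDl mul1r lerD.
  rewrite (_ : h - _ = 2^-1 *: ((x0 + h - a) - (x0 - h - b))).
    rewrite normrZ ger0_norm ?invr_ge0// ltr_pdivrMl//.
    by rewrite (le_lt_trans (ler_normB _ _))// mulr2n mulrDl mul1r ltrD.
  have -> : x0 + h - a - (x0 - h - b) = (h + h) - (a - b).
    rewrite -[x0 + h - a]addrA -[x0 - h - b]addrA opprD addrACA subrr add0r.
    by rewrite !opprD !opprK addrACA.
  rewrite [RHS]scalerBr; congr (_ - _).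
  by rewrite -mulr2n -[h *+ 2]scaler_nat scalerA mulVf ?scale1r// pnatr_eq0.
have n0 : 0 <= n.
  have [|a aA _] := near0 0 1 _ ltr01; first by rewrite normr0.
  exact: le_trans aA.
exists (2 * n / r); first by rewrite !mulr_ge0// invr_ge0 ltW.
move=> x s xs; rewrite le_eqVlt => /orP[/eqP s0|s0].
  move: xs; rewrite -s0 normr_le0 => /eqP ->.
  by exists 0; rewrite -[X in P X](subrr 0) PB !subrr !normr0 mulr0 mul0r.
have c0 : 0 < 2 * s / r by rewrite divr_gt0// mulr_gt0.
have [||a aA ha] := near0 ((2 * s / r)^-1 *: x) (r / 4).
- rewrite normrZ gtr0_norm ?invr_gt0// ltr_pdivrMl// (le_lt_trans xs)//.
  by rewrite divfK ?gt_eqF//; lra.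
- by lra.
exists ((2 * s / r) *: a); rewrite PZ normrZ gtr0_norm//; split.
  rewrite (_ : 2 * n / r * s = 2 * s / r * n); last by ring.
  by rewrite ler_pM2l.
rewrite -[x](scalerKV (lt0r_neq0 c0)) -scalerBr normrZ gtr0_norm//.
rewrite -ler_pdivlMl// (le_trans (ltW ha))// le_eqVlt; apply/orP; left.
by apply/eqP; field; rewrite !gt_eqF.
Qed.

(** Iterating the approximation writes x as a series of vectors whose images
under P are bounded by a geometric series.  The sum z of the images is in M and
x - z is in M', both being closed, so z = P x although P is not yet known to
be continuous. *)
Theorem projection_bounded : exists c : R, forall x, `|P x| <= c * `|x|.
Proof.
have [C C0 /=halve] := projection_halving.
have /choice[g gP] (xs : X * R) : exists a, `|xs.1| <= xs.2 -> 0 <= xs.2 ->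
    `|P a| <= C * xs.2 /\ `|xs.1 - a| <= xs.2 / 2.
  have [h|h] := pselect (`|xs.1| <= xs.2 /\ 0 <= xs.2); last first.
    by exists 0 => ? ?; case: h.
  by have [a aP] := halve _ _ h.1 h.2; exists a.
exists (2 * C) => x.
pose s n : R := `|x| * 2^-1 ^+ n.
(* y n is what remains of x after n corrections *)
pose fix y n := if n is m.+1 then y m - g (y m, s m) else x.
have s_ge0 n : 0 <= s n by rewrite mulr_ge0// exprn_ge0.
have y_le n : `|y n| <= s n.
  elim: n => [|n yn]; first by rewrite /s expr0 mulr1.
  have [_ /=] := gP (y n, s n) yn (s_ge0 n).
  by rewrite /s exprSr mulrA.
pose u n := P (g (y n, s n)).
have u_le n : `|u n| <= geometric (C * `|x|) 2^-1 n.
  have [/= + _] := gP (y n, s n) (y_le n) (s_ge0 n).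
  by rewrite /s mulrA.
have half_lt1 : `|2^-1 : R| < 1 by rewrite ger0_norm ?invr_ge0//; lra.
have cvg_nu : cvgn [normed series u].
  apply: (series_le_cvg _ _ u_le) (is_cvg_geometric_series half_lt1) => // n.
  exact: le_trans (u_le n).
have seriesE n : series u n = P (x - y n).
  elim: n => [|n IHn].
    by rewrite /series /= big_geq// subrr -[X in P X](subrr 0) PB subrr.
  rewrite seriesSr IHn /u /= -[RHS]/(P (x - (y n - g (y n, s n)))).
  by rewrite !PB !opprB addrA addrAC.
set z := limn (series u).
have uz : series u @ \oo --> z by exact: normed_cvg.
have y0 : y n @[n --> \oo] --> 0.
  apply/cvgr0Pnorm_le => e e0.
  have /cvgr0Pnorm_le/(_ e e0) := cvg_geometric `|x| half_lt1.
  apply: filterS => n; apply: le_trans; rewrite (le_trans (y_le n))//.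
  exact: ler_norm.
have Mz : M z.
  apply: (closed_cvg M cM.2 _ _ uz); apply: nearW => n.
  by rewrite seriesE; have [] := MP (x - y n).
have M'xz : M' (x - z).
  have xyz : (x - y n - series u n) @[n --> \oo] --> x - z.
    rewrite -[X in _ --> X - z]subr0.
    by apply: cvgB uz; apply: cvgB y0; exact: cvg_cst.
  apply: (closed_cvg M' cM'.2 _ _ xyz); apply: nearW => n.
  by rewrite seriesE; have [] := MP (x - y n).
have <- : z = P x.
  by rewrite -[in RHS](subrKC z x) (splits_uniq cM.1 cM'.1 MM' MP).
apply: le_trans (lim_series_norm cvg_nu) _; apply: limr_le => //.
apply: nearW => n.
rewrite (_ : 2 * C * _ = C * `|x| / (1 - 2^-1)); last by field.
have -> : [normed series u] n = \sum_(0 <= k < n) `|u k| by [].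
apply: le_trans (ler_sum_nat (fun k _ => u_le k)) _.
rewrite -[leLHS]/(series (geometric (C * `|x|) 2^-1) n) geometric_seriesE;
  last by lra.
rewrite ler_pM2r; last by rewrite invr_gt0; lra.
by rewrite ler_piMr ?mulr_ge0// gerBl exprn_ge0.
Qed.

End projection_bounded.

(** * Complex Banach spaces as real ones *)

(** A complex Banach space with its scalars restricted to the reals; the alias
keeps the two module structures apart. *)
Definition realification (R : realType) (X : completeNormedModType R[i]) :
  Type := X.

Section realification.
Variables (R : realType) (X : completeNormedModType R[i]).
Local Notation XR := (realification X).

HB.instance Definition _ := GRing.Zmodule.copy XR X.

Definition real_scale (a : R) (x : XR) : XR := (a%:C)%C *: (x : X).

Let real_scaleA a b x : real_scale a (real_scale b x) = real_scale (a * b) x.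
Proof. by rewrite /real_scale scalerA -rmorphM. Qed.

Let real_scale1 : left_id 1 real_scale.
Proof. by move=> x; rewrite /real_scale rmorph1 scale1r. Qed.

Let real_scaleDr : right_distributive real_scale +%R.
Proof. by move=> a x y; exact: scalerDr. Qed.

Let real_scaleDl x : {morph real_scale^~ x : a b / a + b}.
Proof. by move=> a b; rewrite /real_scale rmorphD; exact: scalerDl. Qed.

HB.instance Definition _ := GRing.Zmodule_isLmodule.Build R XR
  real_scaleA real_scale1 real_scaleDr real_scaleDl.

(** The norm of a complex space takes its values in R[i], on the real axis. *)
Definition real_norm (x : XR) : R := complex.Re `|x : X|.

Lemma real_normE x : ((real_norm x)%:C)%C = `|x : X|.
Proof. by rewrite /real_norm RRe_real// normr_real. Qed.

Let real_normD x y : real_norm (x + y) <= real_norm x + real_norm y.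
Proof. by rewrite -lecR rmorphD /= !real_normE; exact: ler_normD. Qed.

Let real_normZ a x : real_norm (a *: x) = `|a| * real_norm x.
Proof.
apply: (@complexI R); rewrite rmorphM /= !real_normE.
rewrite [LHS](@normrZ R[i] X); congr (_ * _).
by rewrite normc_def /= expr0n /= addr0 sqrtr_sqr.
Qed.

Let real_norm0_eq0 x : real_norm x = 0 -> x = 0.
Proof.
by move=> x0; apply: (@normr0_eq0 _ X); rewrite -real_normE x0.
Qed.

HB.instance Definition _ := Lmodule_isNormed.Build R XR
  real_normD real_normZ real_norm0_eq0.

Lemma ball_realification (x : XR) e :
  ball x e = ball (x : X) ((e%:C)%C).
Proof.
apply/funext => y; rewrite -!ball_normE /=; apply: propext.
by rewrite -[in X in _ <-> X]real_normE ltcR.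
Qed.

Lemma pos_complexE (e : R[i]) : 0 < e -> e = ((complex.Re e)%:C)%C.
Proof. by move=> e0; rewrite RRe_real// gtr0_real. Qed.

Lemma Re_gt0 (e : R[i]) : 0 < e -> 0 < complex.Re e.
Proof. by rewrite ltcE => /andP[]. Qed.

Lemma nbhs_realification (x : XR) : nbhs x = nbhs (x : X).
Proof.
apply/funext => A; apply: propext; split => /nbhs_ballP[e /= e0 eA].
  apply/nbhs_ballP; exists ((e%:C)%C) => /=; first by rewrite ltcE /= eqxx.
  by rewrite -ball_realification.
apply/nbhs_ballP; exists (complex.Re e) => /=; first exact: Re_gt0.
by rewrite ball_realification -pos_complexE.
Qed.

Let real_cauchy_cvg (F : set_system XR) : ProperFilter F -> cauchy F -> cvg F.
Proof.
move=> FF /cauchy_ballP cF.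
have : cauchy (F : set_system X).
  apply/cauchy_ballP => e e0.
  apply: filterS (cF _ (Re_gt0 e0)) => xy.
  by rewrite ball_realification -pos_complexE.
move=> /cauchy_cvg /cvg_ex[l Fl]; apply/cvg_ex; exists (l : XR) => A.
by rewrite nbhs_realification; exact: Fl.
Qed.

HB.instance Definition _ := Uniform_isComplete.Build XR real_cauchy_cvg.

Lemma closed_subspace_realification (M : set X) :
  closed_subspace M -> closed_subspace (M : set XR).
Proof.
move=> [[M0 ML] cM]; split; first by split=> // a x y; exact: ML.
by move=> x Mx; apply: cM => A; rewrite -nbhs_realification; exact: Mx.
Qed.

End realification.

(** In the complex case, x |-> g x - i g (i x) is complex linear whenever g is
real linear, and has g as its real part. *)
Lemma separation (R : realType) (K : numFieldType)
    (real_or_complex : K = R :> numFieldType \/ K = R[i] :> numFieldType)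
    (X : completeNormedModType K) (M : set X) (u : X) :
  closed_subspace M -> ~ M u ->
  exists f : X -> K, [/\ bounded_functional f, forall m, M m -> f m = 0 &
    f u != 0].
Proof.
case: real_or_complex => KR; subst K => cM Mu.
  have [f [fL f_le fM fu]] := real_separation cM Mu.
  by exists f; split=> //; split=> //; exists 1 => // x; rewrite mul1r.
have [g [gL g_le gM gu]] := @real_separation R (realification X) M u
  (closed_subspace_realification cM) Mu.
have sM := cM.1.
pose i : R[i] := 'i%C.
have gD (x y : X) : g (x + y : X) = g x + g y.
  by have := gL 1 x y; rewrite scale1r mul1r.
have gZ (a : R) (x : X) : g ((a%:C)%C *: x : X) = a * g x.
  have g0 : g 0 = 0 by have := gD 0 0; rewrite addr0; lra.
  by have := gL a x 0; rewrite addr0 g0 addr0.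
have giiZ (x : X) : g (i *: (i *: x)) = - g x.
  by rewrite scalerA -expr2 sqr_i -(rmorphN1 (real_complex R)) gZ mulN1r.
have norm_le (x : X) : `|((g x)%:C)%C| <= `|x|.
  rewrite normc_def /= expr0n /= addr0 sqrtr_sqr -real_normE lecR.
  exact: g_le.
exists (fun x => Complex (g x) (- g (i *: x))); split; first split.
- move=> a x y; case: a => a b.
  have abE z : Complex a b *: z = (a%:C)%C *: z + (b%:C)%C *: (i *: z).
    by rewrite [Complex a b]complexE scalerDl scalerA mulrC.
  have iaE : i *: (Complex a b *: x) = Complex a b *: (i *: x).
    by rewrite !scalerA mulrC.
  rewrite scalerDr !gD iaE !abE !gD !gZ giiZ.
  by apply/eqP; rewrite eq_complex /=; apply/andP; split; apply/eqP; ring.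
- exists 2 => // x; rewrite [Complex _ _]complexE /= mulr2n mulrDl mul1r.
  rewrite (le_trans (ler_normD _ _))// lerD//.
  rewrite normrM rmorphN normrN (le_trans (ler_wpM2l _ (norm_le _)))//.
  by rewrite normrZ mulrA -normrM -expr2 sqr_i normrN1 mul1r.
- move=> m Mm; rewrite !gM ?oppr0//; exact: linear_subspaceZ.
- by apply: contra gu => /eqP [-> _].
Qed.

Lemma complemented_projection (R : realType) (K : numFieldType)
    (real_or_complex : K = R :> numFieldType \/ K = R[i] :> numFieldType)
    (X : completeNormedModType K) (M : set X) :
  closed_subspace M -> complemented M ->
  exists P : X -> X, [/\ bounded_operator P, forall x, M (P x) &
    forall y, M y -> P y = y].
Proof.
move=> cM [M' [cM' MM' MD]].
have /choice[P MP] : forall x, exists y, M y /\ M' (x - y).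
  by move=> x; have [y [z [My M'z ->]]] := MD x; exists y; rewrite addrC addKr.
exists P; split=> [|x|]; last exact: splits_id cM.1 cM'.1 MM' MP.
  split; first exact: splits_linear cM.1 cM'.1 MM' MP.
  case: real_or_complex => KR; subst K.
    exact: projection_bounded cM cM' MM' MP.
  have [c cP] := @projection_bounded R (realification X) M M' P
    (closed_subspace_realification cM) (closed_subspace_realification cM')
    MM' MP.
  by exists ((c%:C)%C) => x; rewrite -!real_normE -rmorphM lecR; exact: cP.
by have [] := MP x.
Qed.

(** * Nests and operators of rank one *)

Section nest_facts.
Variables (K : numFieldType) (X : normedModType K) (N : nest X).
Implicit Types (M : set X) (A B S T : nest_alg N).

Lemma nest_closed_subspace M : nest_set N M -> closed_subspace M.
Proof. by have [+ _ _ _] := nestP N; apply. Qed.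

Lemma nest_minusP M : nest_set N (nest_minus N M).
Proof.
have [_ _ _ NF] := nestP N.
have [|_] // := NF [set M' | nest_set N M' /\ M' `<` M].
by move=> M' [].
Qed.

Lemma nest_minus_sub M : nest_set N M -> nest_minus N M `<=` M.
Proof.
move=> NM; apply: closed_span_sub; first exact: nest_closed_subspace.
by move=> x [M' [_ /properW M'M]] /M'M.
Qed.

Lemma sub_nest_minus M M' :
  nest_set N M' -> M' `<` M -> M' `<=` nest_minus N M.
Proof.
by move=> NM' M'M x M'x; apply: sub_closed_span; exists M'.
Qed.

Lemma nest_algB A B : A - B = (fun x => A x - B x) :> (X -> X).
Proof. by []. Qed.

Lemma nest_algP A : bounded_operator A /\
  forall M x, nest_set N M -> M x -> M (A x).
Proof.
have /set_mem[bA AN] := nest_funP A; split=> // M x NM Mx.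
by apply: AN NM _ _; exists x.
Qed.

Lemma nest_alg_scale A a x : A (a *: x) = a *: A x.
Proof.
have A0 : A 0 = 0.
  by have := nest_alg_linear A (-1) 0 0; rewrite scaler0 addr0 scaleN1r addNr.
by have := nest_alg_linear A a x 0; rewrite addr0 A0 addr0.
Qed.

Lemma nest_alg_inj A B : (forall x, A x = B x) -> A = B.
Proof. by move=> AB; apply/val_inj/funext. Qed.

Lemma nest_algZDl a A B C : (a *: A + B) * C = a *: (A * C) + B * C.
Proof. exact: nest_alg_inj. Qed.

Lemma nest_algZDr a A B C : A * (a *: B + C) = a *: (A * B) + A * C.
Proof. by apply: nest_alg_inj => x; exact: nest_alg_linear. Qed.

Lemma exists_nest_alg (T : X -> X) : bounded_operator T ->
  (forall M x, nest_set N M -> M x -> M (T x)) ->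
  exists A, A = T :> (X -> X).
Proof.
move=> bT TN; have TP : T \in in_nest_alg N.
  by apply/mem_set; split=> // M NM _ [x Mx <-]; exact: TN.
by exists (NestAlg TP).
Qed.

(** The member M is the reason why f # x preserves the nest; see
[exists_rank_one]. *)
Definition nest_rank_one M (x : X) (f : X -> K) := [/\ nest_set N M, M x,
  bounded_functional f & forall z, nest_minus N M z -> f z = 0].

(** A member M' of the nest either contains M, hence x, or is strictly smaller
than M, hence contained in M_- where f vanishes. *)
Lemma exists_rank_one M x f :
  nest_rank_one M x f -> exists A, A = rank_one x f :> (X -> X).
Proof.
move=> [NM Mx bf fM]; apply: exists_nest_alg => [|M' z NM' M'z].
  exact: bounded_operator_rank_one.
have [MM'|MM'] := pselect (M `<=` M').
  by apply: linear_subspaceZ (MM' _ Mx); have [] := nest_closed_subspace NM'.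
have M'M : M' `<=` M.
  by have [_ /(_ _ _ NM NM')[]] := nestP N.
rewrite /rank_one fM ?scale0r; first by have [[]] := nest_closed_subspace NM'.
by apply: sub_nest_minus M'z => //; split.
Qed.

(** The product of f # x by A on the right is (f \o A) # x, and on the left it
is f # (A x): admissible pairs are stable under both. *)
Lemma nest_rank_one_comp M x f A :
  nest_rank_one M x f -> nest_rank_one M x (f \o A).
Proof.
move=> [NM Mx bf fM]; have [bA AN] := nest_algP A; split=> //.
  exact: bounded_functional_comp.
by move=> z Mz /=; apply: fM; apply: AN Mz; exact: nest_minusP.
Qed.

Lemma nest_rank_one_image M x f A :
  nest_rank_one M x f -> nest_rank_one M (A x) f.
Proof. by move=> [NM Mx bf fM]; split=> //; have [_] := nest_algP A; apply. Qed.

Inductive idempotent_span : nest_alg N -> Prop :=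
| idempotent_span_idem E : E * E = E -> idempotent_span E
| idempotent_spanP a S T :
    idempotent_span S -> idempotent_span T -> idempotent_span (a *: S + T).

Lemma idempotent_spanZ a S : idempotent_span S -> idempotent_span (a *: S).
Proof.
move=> sS; rewrite -[_ *: _]addr0; apply: idempotent_spanP => //.
by apply: idempotent_span_idem; rewrite mulr0.
Qed.

Lemma idempotent_spanB S T :
  idempotent_span S -> idempotent_span T -> idempotent_span (S - T).
Proof.
by move=> sS sT; rewrite addrC -scaleN1r; exact: idempotent_spanP.
Qed.

Lemma rank_one_idempotent_span A x f : A = rank_one x f :> (X -> X) ->
  scalar f -> f x != 0 -> idempotent_span A.
Proof.
move=> AE fL fx0.
have -> : A = f x *: ((f x)^-1 *: A).
  by rewrite scalerA mulfV// scale1r.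
apply/idempotent_spanZ/idempotent_span_idem/nest_alg_inj => y.
rewrite -[LHS]/((f x)^-1 *: A ((f x)^-1 *: A y)) nest_algZ AE /rank_one.
rewrite !(scalar_funZ _ _ fL) !scalerA.
by congr (_ *: _); field.
Qed.

(** If f x = 0, then f # x = f # (x + z) - f # z, and f is nonzero at both
x + z and z. *)
Lemma nest_rank_one_span_of_neq0 M x f z A : nest_rank_one M x f ->
  M z -> f z != 0 -> A = rank_one x f :> (X -> X) -> idempotent_span A.
Proof.
move=> Mxf Mz fz0 AE; have [NM Mx bf fM] := Mxf; have [fL _] := bf.
have [fx0|] := eqVneq (f x) 0; last exact: rank_one_idempotent_span AE fL.
have Mxz : M (x + z).
  by apply: linear_subspaceD => //; have [] := nest_closed_subspace NM.
have [|B BE] := @exists_rank_one M (x + z) f; first by split.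
have [|C CE] := @exists_rank_one M z f; first by split.
have -> : A = B - C.
  apply: nest_alg_inj => y; rewrite nest_algB AE BE CE /rank_one.
  by rewrite -scalerBr addrK.
apply: idempotent_spanB.
  apply: (rank_one_idempotent_span BE fL).
  by rewrite (scalar_funD _ _ fL) fx0 add0r.
exact: rank_one_idempotent_span CE fL fz0.
Qed.

End nest_facts.

Section nest_separation.
Variables (R : realType) (K : numFieldType).
Hypothesis real_or_complex : K = R :> numFieldType \/ K = R[i] :> numFieldType.
Variables (X : completeNormedModType K) (N : nest X).
Implicit Types (M : set X) (A B T : nest_alg N).

Lemma nest_separation M u : nest_set N M -> ~ M u ->
  exists2 f : X -> K, bounded_functional f &
    (forall m, M m -> f m = 0) /\ f u != 0.
Proof.
move=> NM Mu; have cM := nest_closed_subspace NM.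
by have [f [bf fM fu]] := separation real_or_complex cM Mu; exists f.
Qed.

(** Otherwise some T z <> 0 is in M_- for every nonzero M, so the intersection L
of the nonzero members is nonzero; but L_- = 0, as the only member strictly
below L is 0. *)
Lemma rank_one_left_separating T :
  (forall A M x f, nest_rank_one N M x f -> A = rank_one x f :> (X -> X) ->
     A * T = 0) -> T = 0.
Proof.
move=> AT0; apply: nest_alg_inj => z; rewrite nest_alg0; apply: contrapT => Tz0.
have minusTz M x : nest_set N M -> M x -> x <> 0 -> nest_minus N M (T z).
  move=> NM Mx x0; apply: contrapT => MTz.
  have [f bf [fM fTz]] := nest_separation (nest_minusP N M) MTz.
  have Mxf : nest_rank_one N M x f by split.
  have [A AE] := exists_rank_one Mxf.
  have /(congr1 (fun B : nest_alg N => B z)) := AT0 A M x f Mxf AE.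
  rewrite nest_algM nest_alg0 /= AE /rank_one => /eqP.
  by rewrite scaler_eq0 (negPf fTz) /= => /eqP /x0.
pose F := [set M | nest_set N M /\ exists2 x, M x & x <> 0].
pose L := \bigcap_(M in F) M.
have NL : nest_set N L.
  by have [_ _ _ NF] := nestP N; have [|] // := NF F; move=> M [].
have LTz : L (T z).
  by move=> M [NM [x Mx x0]]; apply: (nest_minus_sub NM); exact: (minusTz M x).
suff L0 : nest_minus N L `<=` [set 0].
  by case: (Tz0); exact: L0 (minusTz L (T z) NL LTz Tz0).
have [_ _ [N0 _] _] := nestP N.
apply: closed_span_sub (nest_closed_subspace N0) _ => x [M' [NM' M'L] M'x].
apply: contrapT => x0; have [_ ] := M'L; apply => y Ly.
by apply: Ly; split=> //; exists x.
Qed.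

(** A nonzero functional that vanishes on M_- shows that T vanishes on M, so T
is zero on every M with M_- <> X, where X is the whole space.  Either X is
such an M, or the members strictly below X, all of which are such, span a dense
subspace; the kernel of T is closed. *)
Lemma rank_one_right_separating T :
  (forall A M x f, nest_rank_one N M x f -> A = rank_one x f :> (X -> X) ->
     T * A = 0) -> T = 0.
Proof.
move=> TA0; have T_eq0 M x : nest_set N M -> M x ->
    ~ (setT `<=` nest_minus N M) -> T x = 0.
  move=> NM Mx /nonsubset[u [_ Mu]].
  have [f bf [fM fu]] := nest_separation (nest_minusP N M) Mu.
  have Mxf : nest_rank_one N M x f by split.
  have [A AE] := exists_rank_one Mxf.
  have /(congr1 (fun B : nest_alg N => B u)) := TA0 A M x f Mxf AE.
  rewrite nest_algM nest_alg0 /= AE /rank_one nest_alg_scale.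
  by move=> /eqP; rewrite scaler_eq0 (negPf fu) /= => /eqP.
have [_ _ [_ NT] _] := nestP N; have [bT _] := nest_algP T.
apply: nest_alg_inj => x.
have [XX|XX] := pselect (setT `<=` nest_minus N setT); last
  exact: T_eq0 NT I XX.
have : nest_minus N setT x by exact: XX.
apply: closed_span_sub (closed_subspace_kernel bT) _ x => y [M [NM [_ MT]] My].
apply: (T_eq0 M) => // XM; apply: MT => z _.
exact: nest_minus_sub NM _ (XM z I).
Qed.

Hypothesis N_compl :
  forall M, nest_set N M -> nest_minus N M = M -> complemented M.

(** When M_- = M, complementation provides a projection P onto M, and f # x is
the difference of the idempotents P + f # x and P: the cross term f (P y) x is
0 since f vanishes on M.  When M_- <> M and f vanishes on M, adding to f
a functional g that is nonzero on M makes both f + g and g nonzero on M. *)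
Lemma nest_rank_one_idempotent_span A M x f :
  nest_rank_one N M x f -> A = rank_one x f :> (X -> X) -> idempotent_span A.
Proof.
move=> Mxf AE; have [NM Mx bf fM] := Mxf; have [fL _] := bf.
have cM := nest_closed_subspace NM.
have [MM|MM] := pselect (nest_minus N M = M).
  have [P [bP PM PE]] :=
    complemented_projection real_or_complex cM (N_compl NM MM).
  have [|E EE] := @exists_nest_alg _ _ N P bP.
    move=> M' y NM' M'y; have [_ /(_ _ _ NM NM')[MM'|M'M] _ _] := nestP N.
      exact/MM'/PM.
    by rewrite PE//; exact: M'M.
  have fM0 y : M y -> f y = 0 by rewrite -{1}MM; exact: fM.
  have PD y w : P (y + w) = P y + P w.
    by have [PL _] := bP; have := PL 1 y w; rewrite !scale1r.
  have -> : A = (E + A) - E by rewrite addrC addKr.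
  apply: idempotent_spanB; apply/idempotent_span_idem/nest_alg_inj => y.
    have Mfyx : M (f y *: x) by apply: linear_subspaceZ => //; case: cM.
    rewrite -[LHS]/(E (E y + A y) + A (E y + A y)) nest_algD EE AE /rank_one.
    by rewrite PD (PE _ (PM y)) (PE _ Mfyx) (scalar_funD _ _ fL)
      (fM0 _ (PM y)) (fM0 _ Mfyx) addr0 scale0r addr0.
  by rewrite nest_algM /= EE PE.
have [y My Mmy] : exists2 y, M y & ~ nest_minus N M y.
  apply: contrapT => noy; apply: MM; apply/seteqP; split.
    exact: nest_minus_sub.
  by move=> y My; apply: contrapT => Mmy; apply: noy; exists y.
have [fy0|fy0] := eqVneq (f y) 0; last
  exact: nest_rank_one_span_of_neq0 Mxf My fy0 AE.
have [g bg [gM gy]] := nest_separation (nest_minusP N M) Mmy.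
have Mxg : nest_rank_one N M x g by split.
have Mxfg : nest_rank_one N M x (fun z => f z + g z).
  split=> //; first exact: bounded_functionalD.
  by move=> z Mz; rewrite fM// gM// addr0.
have [B BE] := exists_rank_one Mxg; have [C CE] := exists_rank_one Mxfg.
have -> : A = C - B.
  apply: nest_alg_inj => z; rewrite nest_algB AE BE CE /rank_one.
  by rewrite -scalerBl addrK.
apply: idempotent_spanB.
  by apply: nest_rank_one_span_of_neq0 Mxfg My _ CE; rewrite fy0 add0r.
exact: nest_rank_one_span_of_neq0 Mxg My gy BE.
Qed.

(** * Maps preserving zero products *)

(** The relation tau (S B) = S tau B is linear in S, so it passes from
idempotents to their span; it is then used for S = E and for S = E A. *)
Lemma left_zero_preserver (tau : {linear nest_alg N -> nest_alg N}) :
  (forall A B, A * B = 0 -> A * tau B = 0) ->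
  forall A, tau A = A * tau 1.
Proof.
move=> tau0.
have tau_idem E B : E * E = E -> tau (E * B) = E * tau B.
  move=> EE.
  have E1 : E * tau (B - E * B) = 0.
    by apply: tau0; rewrite mulrBr mulrA EE subrr.
  have E2 : (1 - E) * tau (E * B) = 0.
    by apply: tau0; rewrite mulrBl mul1r mulrA EE subrr.
  move: E1 E2; rewrite linearB mulrBr mulrBl mul1r.
  by move=> /subr0_eq -> /subr0_eq.
have tau_span S B : idempotent_span S -> tau (S * B) = S * tau B.
  elim=> [E|a S1 S2 _ IH1 _ IH2]; first exact: tau_idem.
  by rewrite !nest_algZDl linearP IH1 IH2.
move=> A; apply/eqP; rewrite -subr_eq0; apply/eqP.
apply: rank_one_left_separating => E M x f Mxf EE.
have sE := nest_rank_one_idempotent_span Mxf EE.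
have sEA : idempotent_span (E * A).
  apply: (nest_rank_one_idempotent_span (nest_rank_one_comp A Mxf)).
  by rewrite nest_algM EE.
by rewrite mulrBr mulrA -tau_span// -tau_span// mulr1 subrr.
Qed.

Lemma right_zero_preserver (delta : {linear nest_alg N -> nest_alg N}) :
  (forall A B, A * B = 0 -> delta A * B = 0) ->
  forall A, delta A = delta 1 * A.
Proof.
move=> delta0.
have delta_idem E B : E * E = E -> delta (B * E) = delta B * E.
  move=> EE.
  have E1 : delta (B - B * E) * E = 0.
    by apply: delta0; rewrite mulrBl -mulrA EE subrr.
  have E2 : delta (B * E) * (1 - E) = 0.
    by apply: delta0; rewrite mulrBr mulr1 -mulrA EE subrr.
  move: E1 E2; rewrite linearB mulrBl mulrBr mulr1.
  by move=> /subr0_eq -> /subr0_eq.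
have delta_span S B : idempotent_span S -> delta (B * S) = delta B * S.
  elim=> [E|a S1 S2 _ IH1 _ IH2]; first exact: delta_idem.
  by rewrite !nest_algZDr linearP IH1 IH2.
move=> A; apply/eqP; rewrite -subr_eq0; apply/eqP.
apply: rank_one_right_separating => E M x f Mxf EE.
have sE := nest_rank_one_idempotent_span Mxf EE.
have sAE : idempotent_span (A * E).
  apply: (nest_rank_one_idempotent_span (nest_rank_one_image A Mxf)).
  by apply/funext => y; rewrite nest_algM /= EE /rank_one nest_alg_scale.
by rewrite mulrBl -mulrA -delta_span// -delta_span// mul1r subrr.
Qed.

End nest_separation.

(** For rho, both one-sided results give the same D = rho 1, which therefore
commutes with the algebra. *)
Theorem corollary3p3
  (R : realType) (K : numFieldType)
  (real_or_complex : K = R :> numFieldType \/ K = R[i] :> numFieldType)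
  (X : completeNormedModType K)
  (dim_ge2 : exists x y : X,
     forall a b : K, a *: x + b *: y = 0 -> a = 0 /\ b = 0)
  (N : nest X)
  (N_compl : forall M, nest_set N M -> nest_minus N M = M -> complemented M)
  (tau delta rho : {linear nest_alg N -> nest_alg N}) :
  [/\ (forall A B : nest_alg N, A * B = 0 -> A * tau B = 0) <->
        (exists D : nest_alg N, forall A : nest_alg N, tau A = A * D),
      (forall A B : nest_alg N, A * B = 0 -> delta A * B = 0) <->
        (exists D : nest_alg N, forall A : nest_alg N, delta A = D * A) &
      (forall A B : nest_alg N, A * B = 0 -> A * rho B = 0 /\ rho A * B = 0) <->
        (exists D : nest_alg N,
           (forall A : nest_alg N, A * D = D * A) /\
           (forall A : nest_alg N, rho A = A * D))].
Proof.
have left_mul := left_zero_preserver real_or_complex N_compl.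
have right_mul := right_zero_preserver real_or_complex N_compl.
split; split.
- by move=> tau0; exists (tau 1); exact: left_mul.
- by move=> [D tauE] A B AB; rewrite tauE mulrA AB mul0r.
- by move=> delta0; exists (delta 1); exact: right_mul.
- by move=> [D deltaE] A B AB; rewrite deltaE -mulrA AB mulr0.
- move=> rho0.
  have rhoL : forall A, rho A = A * rho 1.
    by apply: left_mul => A B /rho0[].
  have rhoR : forall A, rho A = rho 1 * A.
    by apply: right_mul => A B /rho0[].
  by exists (rho 1); split=> // A; rewrite -rhoL rhoR.
- move=> [D [DC rhoE]] A B AB; rewrite !rhoE mulrA AB mul0r; split=> //.
  by rewrite -mulrA -DC mulrA AB mul0r.
Qed.
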